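(* Let $\mu$ be a valuated matroid of rank $r$ on $[n]$ and let $\mu^*$ be its dual, and regard $\mu\oplus\mu^*$ as a valuated matroid of rank $n$ on $[2n]$, with $\mu$ on the elements $1,\dots,n$ and $\mu^*$ on the elements $\bar1,\dots,\bar n$ (element $\bar i$ corresponding to $i$). Then: (1) if $\mu$ is realizable over a field $\mathbb{K}$ of characteristic $p$, then $\mu\oplus\mu^*\in\mathrm{TSpGr}_p(n,2n)$; (2) for any $\mu$, $\mu\oplus\mu^*\in\mathrm{SpDr}(n,2n)$, i.e. $\mu\oplus\mu^*$ satisfies the tropical symplectic relations; (3) the conormal bundle $L_{\mu\oplus\mu^*}$ is isotropic; (4) if $\mu$ and $\mu^*$ are transversal, then $\mu\oplus\mu^*$ has a symmetric presentation if and only if $\mu$ has a single basis (i.e., exactly one coordinate of $\mu$ is finite).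
   Context: $[2n]=\{1,\dots,n,\bar1,\dots,\bar n\}$ ordered $1<\dots<n<\bar1<\dots<\bar n$, $\bar{\bar i}=i$, $Si=S\cup\{i\}$. $\mathbb{T}=\mathbb{R}\cup\{\infty\}$, $\oplus=\min$, $\odot=+$. A valuated matroid of rank $k$ on $E$ is $\mu\in(\mathbb{T}^{\binom{E}{k}}\setminus\{\infty\})/\mathbb{R}(1,\dots,1)$ with: for all $S\in\binom{E}{k-1}$, $T\in\binom{E}{k+1}$, $\min_{i\in T\setminus S}(\mu_{T\setminus i}+\mu_{Si})$ attained at least twice or $\infty$. Dual: $\mu^*_B=\mu_{[n]\setminus B}$ (rank $n-r$). Direct sum on disjoint ground sets: $(\mu_1\oplus\mu_2)_J=(\mu_1)_{J\cap E_1}+(\mu_2)_{J\cap E_2}$ if $|J\cap E_1|=\mathrm{rank}(\mu_1)$, else $\infty$. $L_\nu=\{x\in\mathbb{T}^E:\forall T\in\binom{E}{k+1},\ \min_{i\in T}(\nu_{T\setminus i}+x_i)\text{ attained at least twice or }\infty\}$; $L_{\mu\oplus\mu^*}$ is called the conormal bundle of $\mu$. $\mu$ is realizable over a valued field $\mathbb{K}$ if $\mu_J=\mathrm{val}(X_J)$ for the Plücker vector $X$ of some linear subspace of $\mathbb{K}^n$. Points $x,y\in\mathbb{T}^{2n}$ are orthogonal if $\min_{i\in[2n]}(x_i+y_{\bar i})$ is attained at least twice; isotropic = pairwise orthogonal points. $\mathrm{SpDr}(n,2n)$: valuated matroids $\nu$ of rank $n$ on $[2n]$ such that for each $S\in\binom{[2n]}{n-2}$,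 $\min\{\nu_{S\cup\{i,\bar i\}}:i\in[n],\{i,\bar i\}\cap S=\emptyset\}$ is attained at least twice (or is $\infty$). $\mathrm{TSpGr}_p(n,2n)$: for $\mathbb{K}$ algebraically closed of characteristic $p$ with non-Archimedean valuation, the set of $w\in\mathbb{TP}^{\binom{2n}{n}-1}$ lying in the tropical hypersurface (minimum of $\mathrm{val}(c_u)+u\cdot w$ attained at least twice) of every polynomial $f=\sum c_uX^u$ vanishing on Plücker vectors of all $n$-dimensional subspaces of $\mathbb{K}^{2n}$ isotropic for the standard symplectic form ($\omega(e_i,e_{\bar i})=1=-\omega(e_{\bar i},e_i)$, other pairings $0$). Stiefel map: for $M\in\mathbb{T}^{k\times m}$, $\pi(M)_J=\min_\sigma\sum_rM_{r,\sigma(r)}$ over bijections from rows to columns $J$; $\nu$ is transversal if $\nu=\pi(M)$ for some $M$. $\nu$ on $[2n]$ has a symmetric presentation if $\nu=\pi(A|B)$ with $A,B\in\mathbb{T}^{n\times n}$ (columns of $(A|B)$ indexed $1,\dots,n,\bar1,\dots,\bar n$) and $A\odot B^T$ symmetric, $(A\odot B^T)_{ij}=\min_l(A_{il}+B_{jl})$. *)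

(* Defs.v *)
(* Tropical numbers T = R ∪ {∞} are modelled as [option R]
   (None = ∞) for an arbitrary [R : realType]. *)
From HB Require Import structures.
From mathcomp Require Import all_boot all_order all_algebra all_fingroup.
From mathcomp Require Import reals.
From mathcomp Require Import mpoly.

Set Implicit Arguments.
Unset Strict Implicit.
Unset Printing Implicit Defensive.

Import Order.TTheory GRing.Theory Num.Theory.
Local Open Scope ring_scope.

Section Tropical.
Variable R : realType.

Definition trop := option R.

Definition tadd (a b : trop) : trop :=
  match a, b with Some x, Some y => Some (x + y) | _, _ => None end.

Definition tle (a b : trop) : bool :=
  match a, b with
  | _, None => true
  | None, Some _ => false
  | Some x, Some y => x <= y
  end.

Definition tmin (a b : trop) : trop := if tle a b then a else b.

Definition tmin_seq (s : seq trop) : trop := foldr tmin None s.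

Definition tsum (s : seq trop) : trop := foldr tadd (Some 0) s.

(** k ⊙-power of a tropical number, with the convention 0·∞ = 0 *)
Definition tnmul (k : nat) (a : trop) : trop :=
  if k == 0%N then Some 0 else
  match a with Some x => Some (x *+ k) | None => None end.

Definition attained_twice (s : seq trop) : bool :=
  (1 < count (pred1 (tmin_seq s)) s)%N.

Definition tmin_twice (s : seq trop) : bool :=
  (tmin_seq s == None) || attained_twice s.

(** Valuated matroid of rank k on a finite ground set E, given by a
    representative mu : {set E} -> T (only the values on k-subsets matter). *)
Definition valuated_matroid (E : finType) (k : nat) (mu : {set E} -> trop) : Prop :=
  (exists B : {set E}, #|B| = k /\ mu B != None) /\
  forall S T : {set E}, #|S|.+1 = k -> #|T| = k.+1 ->
    tmin_twice [seq tadd (mu (T :\ i)) (mu (i |: S)) | i <- enum (T :\: S)].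

(** equality of valuated matroids of rank k, i.e. equality modulo R(1,...,1) *)
Definition proj_eq (E : finType) (k : nat) (mu nu : {set E} -> trop) : Prop :=
  exists c : R, forall J : {set E}, #|J| = k -> mu J = tadd (nu J) (Some c).

Definition mdual (n : nat) (mu : {set 'I_n} -> trop) : {set 'I_n} -> trop :=
  fun B => mu (~: B).

(** ground set [2n] = 'I_(n+n): lshift n i is i, rshift n i is \bar i,
    so that 1 < ... < n < \bar 1 < ... < \bar n. *)
Definition bar (n : nat) (i : 'I_(n + n)) : 'I_(n + n) :=
  match split i with inl j => rshift n j | inr j => lshift n j end.

Definition lpart (n : nat) (J : {set 'I_(n + n)}) : {set 'I_n} :=
  [set i | lshift n i \in J].
Definition rpart (n : nat) (J : {set 'I_(n + n)}) : {set 'I_n} :=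
  [set i | rshift n i \in J].

Definition dsum (n r1 : nat) (mu1 mu2 : {set 'I_n} -> trop) :
    {set 'I_(n + n)} -> trop :=
  fun J => if #|lpart J| == r1 then tadd (mu1 (lpart J)) (mu2 (rpart J)) else None.

Definition Lnu (E : finType) (k : nat) (nu : {set E} -> trop) (x : E -> trop) : Prop :=
  forall T : {set E}, #|T| = k.+1 ->
    tmin_twice [seq tadd (nu (T :\ i)) (x i) | i <- enum T].

Definition orthogonal (n : nat) (x y : 'I_(n + n) -> trop) : bool :=
  attained_twice [seq tadd (x i) (y (bar i)) | i <- enum 'I_(n + n)].

Definition isotropic (n : nat) (L : ('I_(n + n) -> trop) -> Prop) : Prop :=
  forall x y, L x -> L y -> orthogonal x y.

Definition SpDr (n : nat) (nu : {set 'I_(n + n)} -> trop) : Prop :=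
  valuated_matroid n nu /\
  forall S : {set 'I_(n + n)}, (#|S| + 2)%N = n ->
    tmin_twice [seq nu (lshift n i |: (rshift n i |: S)) |
                 i <- enum [pred i : 'I_n | (lshift n i \notin S) && (rshift n i \notin S)]].

Definition stiefel (k m : nat) (M : 'I_k -> 'I_m -> trop) : {set 'I_m} -> trop :=
  fun J =>
    match #|J| =P k with
    | ReflectT e =>
        tmin_seq (map (fun s : {perm 'I_k} =>
                   tsum [seq M i (enum_val (cast_ord (esym e) (s i))) | i <- enum 'I_k])
                 (enum [set: {perm 'I_k}]))
    | ReflectF _ => None
    end.

Definition trop_transversal (m k : nat) (nu : {set 'I_m} -> trop) : Prop :=
  exists M : 'I_k -> 'I_m -> trop, proj_eq k nu (stiefel M).

Definition concat_mx (n : nat) (A B : 'I_n -> 'I_n -> trop) : 'I_n -> 'I_(n + n) -> trop :=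
  fun i c => match split c with inl j => A i j | inr j => B i j end.

Definition tmulT (n : nat) (A B : 'I_n -> 'I_n -> trop) (i j : 'I_n) : trop :=
  tmin_seq [seq tadd (A i l) (B j l) | l <- enum 'I_n].

Definition symmetric_presentation (n : nat) (nu : {set 'I_(n + n)} -> trop) : Prop :=
  exists A B : 'I_n -> 'I_n -> trop,
    proj_eq n nu (stiefel (concat_mx A B)) /\
    forall i j, tmulT A B i j = tmulT A B j i.

Definition single_basis (n r : nat) (mu : {set 'I_n} -> trop) : Prop :=
  #|[set J : {set 'I_n} | (#|J| == r) && (mu J != None)]| = 1%N.

Definition is_valuation (K : fieldType) (v : K -> trop) : Prop :=
  (forall x, (v x == None) = (x == 0)) /\
  (forall x y, v (x * y) = tadd (v x) (v y)) /\
  (forall x y, tle (tmin (v x) (v y)) (v (x + y))).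

Definition has_char (p : nat) (K : fieldType) : Prop :=
  if p == 0%N then [pchar K] =i pred0 else p \in [pchar K].

(** Plücker coordinate X_J of the row space of M : the maximal minor on the
    columns J (in increasing order); 0 if #|J| <> k. *)
Definition pminor (K : fieldType) (k m : nat) (M : 'M[K]_(k, m)) (J : {set 'I_m}) : K :=
  match #|J| =P k with
  | ReflectT e => \det (\matrix_(i, j) M i (enum_val (cast_ord (esym e) j)))
  | ReflectF _ => 0
  end.

Definition realizable (K : fieldType) (v : K -> trop) (n r : nat)
    (mu : {set 'I_n} -> trop) : Prop :=
  exists M : 'M[K]_(r, n), row_free M /\
    exists c : R, forall J : {set 'I_n}, #|J| = r -> mu J = tadd (v (pminor M J)) (Some c).

Definition sympl_mx (K : fieldType) (n : nat) : 'M[K]_(n + n) :=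
  \matrix_(a, b)
    match split a, split b with
    | inl i, inr j => (i == j)%:R
    | inr i, inl j => - (i == j)%:R
    | _, _ => 0
    end.

Definition nsubsets (n : nat) : {set {set 'I_(n + n)}} :=
  [set J : {set 'I_(n + n)} | #|J| == n].

Definition var_set (n : nat) (i : 'I_#|nsubsets n|) : {set 'I_(n + n)} :=
  enum_val i.

Definition vanishes_on_LGr (K : fieldType) (n : nat) (f : {mpoly K[#|nsubsets n|]}) : Prop :=
  forall M : 'M[K]_(n, n + n),
    row_free M -> M *m sympl_mx K n *m M^T = 0 ->
    f.@[fun i => pminor M (var_set i)] = 0.

Definition in_trop_hypersurface (K : fieldType) (v : K -> trop) (N : nat)
    (f : {mpoly K[N]}) (w : 'I_N -> trop) : bool :=
  tmin_twice [seq tadd (v f@_u) (tsum [seq tnmul (u i) (w i) | i <- enum 'I_N])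
             | u <- msupp f].

(** TSpGr_p(n,2n), computed over the algebraically closed valued field (K,v)
    (of characteristic p) *)
Definition TSpGr (K : closedFieldType) (v : K -> trop) (n : nat)
    (w : {set 'I_(n + n)} -> trop) : Prop :=
  (exists J : {set 'I_(n + n)}, #|J| = n /\ w J != None) /\
  forall f : {mpoly K[#|nsubsets n|]}, vanishes_on_LGr f ->
    in_trop_hypersurface v f (fun i => w (var_set i)).

End Tropical.

(* Main.v *)
(** Both halves of [mu (+) mu^*] obey the same exchange relations, because the
    relations of [mu^*] are those of [mu] on complements; this gives (2).

    (1) If [mu] comes from the row space of [M], complete [M] to an invertible
    [W]. The last columns of [W^-1] span the annihilator [N] of [M], the matrix
    [diag(M, N)] is Lagrangian, and by Jacobi's identity its minors have the
    valuations prescribed by [mu (+) mu^*], up to one real constant. That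
    constant need not be a value of the field, so a vanishing polynomial is
    first split into its homogeneous components.

    (3) The bundle splits into [L_mu] and [L_{mu^*}], and these are orthogonal:
    a basis [B] minimizing [mu B - x(B)] may be taken to contain a given [i],
    and the cocircuit of [B \ i] tested on [y] produces a second minimum.

    (4) In any presentation of a direct sum no row meets both summands outside
    the coloops. Two distinct bases would give an element [a] for which [a] and
    [\bar a] both lie in rows and are not coloops, say rows [i] and [j]; then
    entry [(i, j)] of the product is finite and entry [(j, i)] is not. *)
Require Import Defs.
From HB Require Import structures.
From mathcomp Require Import all_boot all_order all_algebra all_fingroup.
From mathcomp Require Import reals.
From mathcomp Require Import mpoly.
From mathcomp Require Import lra zify.

Set Implicit Arguments.
Unset Strict Implicit.
Unset Printing Implicit Defensive.

Import Order.TTheory GRing.Theory Num.Theory.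
Local Open Scope ring_scope.

(** * Order, finiteness and repeated minima in the tropical semiring *)

Section TropicalMinimum.
Variable R : realType.
Implicit Types (a b c : trop R) (s : seq (trop R)).

Lemma tle_refl a : tle a a.
Proof. by case: a => //= x. Qed.

Lemma tle_trans b a c : tle a b -> tle b c -> tle a c.
Proof. by case: a b c => [x|] [y|] [z|] //=; apply: le_trans. Qed.

Lemma tle_anti a b : tle a b -> tle b a -> a = b.
Proof.
by case: a b => [x|] [y|] //= xy yx; congr Some; apply/eqP; rewrite eq_le xy.
Qed.

Lemma tle_fin a b : b != None -> tle a b -> a != None.
Proof. by case: a b => [x|] [y|]. Qed.

Lemma tadd_fin a b : (tadd a b != None) = (a != None) && (b != None).
Proof. by case: a b => [x|] [y|]. Qed.

Lemma tle_tmin a b c : tle a (tmin b c) = tle a b && tle a c.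
Proof.
rewrite /tmin; case: ifP => [bc|].
  by apply/idP/andP => [ab|[]//]; split=> //; apply: tle_trans bc.
case: a b c => [x|] [y|] [z|] //= /negbT; rewrite -?ltNge ?andbT// => zy.
by apply/idP/andP => [ab|[]//]; split=> //; apply: le_trans (ltW zy).
Qed.

Lemma tmin_seq_le s a : a \in s -> tle (tmin_seq s) a.
Proof.
elim: s => //= b s IH; rewrite in_cons => /predU1P[->|/IH ?].
  by have := tle_refl (tmin b (tmin_seq s)); rewrite tle_tmin => /andP[].
apply: tle_trans (_ : tle (tmin_seq s) a) => //.
by have := tle_refl (tmin b (tmin_seq s)); rewrite tle_tmin => /andP[].
Qed.

Lemma tmin_seq_mem s : tmin_seq s != None -> tmin_seq s \in s.
Proof.
elim: s => //= b s IH; rewrite /tmin in_cons; case: ifP => [_ _|_ /IH ->].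
  by rewrite eqxx.
by rewrite orbT.
Qed.

(** At a minimizer the right-hand side yields a second one; conversely, one of two minimizers
    differs from the given [i]. An infinite minimum leaves no finite term to test. Since [r] is
    duplicate-free, repeated positions are distinct indices. *)
Lemma tmin_twiceP (I : eqType) (r : seq I) (F : I -> trop R) : uniq r ->
  reflect (forall i, i \in r -> F i != None ->
             exists j, [/\ j \in r, j != i & tle (F j) (F i)])
          (tmin_twice [seq F i | i <- r]).
Proof.
move=> ur; set m := tmin_seq [seq F i | i <- r].
have le_m i : i \in r -> tle m (F i) by move=> ?; apply/tmin_seq_le/map_f.
have cE : count (pred1 m) [seq F i | i <- r] = size [seq i <- r | F i == m].
  by rewrite count_map size_filter.
rewrite /tmin_twice /attained_twice -/m cE; apply: (iffP orP).
- case=> [/eqP m0 i /le_m|two i ir _]; first by rewrite m0; case: (F i).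
  have uq := filter_uniq (fun i => F i == m) ur.
  have memE k := mem_filter (fun i => F i == m) k r.
  case: [seq i <- r | F i == m] two uq memE => [|x [|y t]] //= _ /andP[].
  rewrite in_cons negb_or => /andP[xy _] _ memE.
  have := memE x; rewrite mem_head => /esym/andP[/eqP Fx xr].
  have := memE y; rewrite !in_cons eqxx orbT => /esym/andP[/eqP Fy yr].
  have [xi|] := eqVneq x i; last by exists x; split=> //; rewrite Fx; apply: le_m.
  by exists y; rewrite -{1}xi eq_sym; split=> //; rewrite Fy; apply: le_m.
- move=> H; have [->|m0] := eqVneq m None; [by left|right].
  have /mapP[i ir mE] := tmin_seq_mem m0.
  have [] := H i ir; first by rewrite -mE.
  move=> j [jr ji leji].
  have Fj : F j = m by apply: tle_anti; rewrite ?le_m // /m mE.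
  rewrite -[2%N]/(size [:: i; j]); apply: uniq_leq_size.
    by rewrite /= inE eq_sym ji.
  by move=> k; rewrite !inE mem_filter => /orP[]/eqP->;
     rewrite ?ir ?jr ?Fj ?eqxx //= -mE eqxx.
Qed.

(** Orthogonality makes no exception for an infinite minimum, but two or more infinite entries
    repeat that minimum anyway. *)
Lemma tmin_twice_attained s : (1 < size s)%N -> tmin_twice s -> attained_twice s.
Proof.
move=> s1 /orP[/eqP m0|//]; rewrite /attained_twice m0.
suff: all (pred1 (None : trop R)) s by rewrite all_count => /eqP->.
apply/allP => a /tmin_seq_le; rewrite m0; by case: a.
Qed.

End TropicalMinimum.

Lemma split_lshift m n (i : 'I_m) : split (lshift n i) = inl i.
Proof. exact: (unsplitK (inl i)). Qed.

Lemma split_rshift m n (i : 'I_n) : split (rshift m i) = inr i.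
Proof. exact: (unsplitK (inr i)). Qed.

(** * Subsets of [[2n]] as pairs of subsets of [[n]] *)

Section Parts.
Variable n : nat.
Implicit Types (S T J : {set 'I_(n + n)}) (i : 'I_n).

Lemma lpartU_l i J : lpart (lshift n i |: J) = i |: lpart J.
Proof. by apply/setP => j; rewrite !inE eq_shift. Qed.
Lemma lpartU_r i J : lpart (rshift n i |: J) = lpart J.
Proof. by apply/setP => j; rewrite !inE eq_shift. Qed.
Lemma rpartU_l i J : rpart (lshift n i |: J) = rpart J.
Proof. by apply/setP => j; rewrite !inE eq_shift. Qed.
Lemma rpartU_r i J : rpart (rshift n i |: J) = i |: rpart J.
Proof. by apply/setP => j; rewrite !inE eq_shift. Qed.
Lemma lpartD_l i J : lpart (J :\ lshift n i) = lpart J :\ i.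
Proof. by apply/setP => j; rewrite !inE eq_shift. Qed.
Lemma lpartD_r i J : lpart (J :\ rshift n i) = lpart J.
Proof. by apply/setP => j; rewrite !inE eq_shift. Qed.
Lemma rpartD_l i J : rpart (J :\ lshift n i) = rpart J.
Proof. by apply/setP => j; rewrite !inE eq_shift. Qed.
Lemma rpartD_r i J : rpart (J :\ rshift n i) = rpart J :\ i.
Proof. by apply/setP => j; rewrite !inE eq_shift. Qed.

Definition partE := (lpartU_l, lpartU_r, rpartU_l, rpartU_r,
  lpartD_l, lpartD_r, rpartD_l, rpartD_r).

Definition join_parts (A B : {set 'I_n}) : {set 'I_(n + n)} :=
  [set c | match split c with inl i => i \in A | inr i => i \in B end].

Lemma lpart_join A B : lpart (join_parts A B) = A.
Proof. by apply/setP => i; rewrite !inE split_lshift. Qed.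
Lemma rpart_join A B : rpart (join_parts A B) = B.
Proof. by apply/setP => i; rewrite !inE split_rshift. Qed.
Lemma join_parts_id J : join_parts (lpart J) (rpart J) = J.
Proof. by apply/setP => c; rewrite inE; case: split_ordP => i ->; rewrite inE. Qed.

Lemma card_parts J : (#|lpart J| + #|rpart J|)%N = #|J|.
Proof.
rewrite -!sum1_card [RHS]big_mkcond big_split_ord /=.
by congr addn; rewrite [LHS]big_mkcond; apply: eq_bigr => i _; rewrite inE.
Qed.

Lemma bar_l i : bar (lshift n i) = rshift n i.
Proof. by rewrite /bar split_lshift. Qed.
Lemma bar_r i : bar (rshift n i) = lshift n i.
Proof. by rewrite /bar split_rshift. Qed.

End Parts.

(** * Tropical sums, and cardinalities under an exchange *)

Section TropicalSum.
Variable R : realType.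
Implicit Types a b c d : trop R.

(** Here [b] and [d] stand for the summand in which no exchange takes place. *)
Lemma tle_tadd4 a b c d a' c' : tle (tadd a c) (tadd a' c') ->
  tle (tadd (tadd a b) (tadd c d)) (tadd (tadd a' b) (tadd c' d)).
Proof. by case: a b c d a' c' => [a|] [b|] [c|] [d|] [a'|] [c'|] //=; lra. Qed.

Lemma taddC a b : tadd a b = tadd b a.
Proof. by case: a b => [a|] [b|] //=; rewrite addrC. Qed.

End TropicalSum.

Lemma cardD1_in (E : finType) (A : {set E}) i : i \in A -> #|A| = #|A :\ i|.+1.
Proof. by move=> iA; rewrite (cardsD1 i) iA. Qed.

Lemma cardD1_pred (E : finType) (A : {set E}) i k :
  i \in A -> #|A| = k.+1 -> #|A :\ i| = k.
Proof. by move=> /cardD1_in -> []. Qed.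

Lemma cardU1_notin (E : finType) (A : {set E}) i :
  i \notin A -> #|i |: A| = #|A|.+1.
Proof. by move=> iA; rewrite cardsU1 iA. Qed.

Lemma card_swap (E : finType) (B : {set E}) i j :
  i \notin B -> j \in B -> #|i |: (B :\ j)| = #|B|.
Proof.
by move=> iB jB; rewrite cardU1_notin ?inE ?(negPf iB) ?andbF // -cardD1_in.
Qed.

(** * Exchange relations and the tropical linear space of the direct sum *)

Section ConormalBundle.
Variables (R : realType) (n r : nat) (mu : {set 'I_n} -> trop R).
Hypothesis mu_vm : valuated_matroid r mu.
Let nu := dsum r mu (mdual mu).
Implicit Types (S T J B : {set 'I_n}) (x y : 'I_n -> trop R).

Lemma exchange S T i : #|S|.+1 = r -> #|T| = r.+1 -> i \in T -> i \notin S ->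
  tadd (mu (T :\ i)) (mu (i |: S)) != None ->
  exists j, [/\ j \in T, j \notin S, j != i &
    tle (tadd (mu (T :\ j)) (mu (j |: S))) (tadd (mu (T :\ i)) (mu (i |: S)))].
Proof.
move=> cS cT iT iS fin; case: mu_vm => _ /(_ S T cS cT) /tmin_twiceP.
case/(_ (enum_uniq _) i); rewrite ?mem_enum ?inE ?iT ?iS //.
by move=> j [+ ji le_ji]; rewrite mem_enum inE => /andP[jS jT]; exists j.
Qed.

Lemma dsum_fin K : nu K != None ->
  [/\ #|lpart K| = r, mu (lpart K) != None & mu (~: rpart K) != None].
Proof.
by rewrite /nu /dsum /mdual; case: (_ =P r) => [->|//]; rewrite tadd_fin => /andP[].
Qed.

Lemma dsumE K : #|lpart K| = r -> nu K = tadd (mu (lpart K)) (mu (~: rpart K)).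
Proof. by rewrite /nu /dsum /mdual => ->; rewrite eqxx. Qed.

Lemma setCD1 B i : ~: (B :\ i) = i |: ~: B.
Proof. by rewrite setCD setUC. Qed.

Lemma setCU1 B i : ~: (i |: B) = ~: B :\ i.
Proof. by rewrite setCU setIC -setDE. Qed.

Lemma basis_exists : exists2 B : {set 'I_n}, #|B| = r & mu B != None.
Proof. by case: mu_vm => -[B [cB fB]] _; exists B. Qed.

Lemma rank_le : (r <= n)%N.
Proof. by have [B <- _] := basis_exists;
    rewrite -[X in (_ <= X)%N]card_ord max_card. Qed.

Lemma dsum_fin_exists : exists2 K : {set 'I_(n + n)}, #|K| = n & nu K != None.
Proof.
have [B cB fB] := basis_exists; exists (join_parts B (~: B)).
  by rewrite -card_parts lpart_join rpart_join cardsC card_ord.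
by rewrite dsumE lpart_join // rpart_join setCK tadd_fin fB.
Qed.

(** A finite term at [k] fixes the sizes of all four parts, so the exchange can be made inside the
    half containing [k], the other half being unchanged. *)
Lemma dsum_valuated : valuated_matroid n nu.
Proof.
split; first by have [K] := dsum_fin_exists; exists K.
move=> S T cS cT; apply/tmin_twiceP; first exact: enum_uniq.
move=> k; rewrite mem_enum inE => /andP[kS kT].
rewrite tadd_fin => /andP[].
have := card_parts S; have := card_parts T; rewrite cT.
case: (split_ordP k) kS kT => i -> iS iT cpT cpS
  /dsum_fin[+ + +] /dsum_fin[]; rewrite !partE.
- move=> cT1 fT1 fT2 cS1 fS1 fS2.
  have iT' : i \in lpart T by rewrite inE.
  have iS' : i \notin lpart S by rewrite inE.
  have := cardD1_in iT'; rewrite cT1 => cT1'.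
  rewrite cardU1_notin // in cS1.
  have [|j [jT jS ji le_ji]] := exchange cS1 cT1' iT' iS'.
    by rewrite tadd_fin fT1.
  have cTj : #|lpart T :\ j| = r by apply: cardD1_pred cT1'.
  exists (lshift n j); rewrite mem_enum; split; first by move: jT jS;
      rewrite !inE => -> ->.
    by rewrite (inj_eq (@lshift_inj _ _)).
  by rewrite !dsumE ?partE ?cardU1_notin //; apply: tle_tadd4.
- move=> cT1 fT1 fT2 cS1 fS1 fS2.
  have iT' : i \notin ~: rpart T by rewrite !inE negbK.
  have iS' : i \in ~: rpart S by rewrite !inE.
  have cT2 : #|~: rpart T|.+1 = r.
    have := cardsC (rpart T); move: iT'.
    rewrite inE negbK card_ord => /cardD1_in; lia.
  have cS2 : #|~: rpart S| = r.+1.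
    have := cardsC (rpart S); rewrite card_ord; lia.
  (* In the barred half complements reverse the roles: [~: rpart S] is the large set and
     [~: rpart T] the small one. *)
  have [|j [jS jT ji le_ji]] := exchange cT2 cS2 iS' iT'.
    by rewrite tadd_fin -setCD1 -setCU1 fS2.
  exists (rshift n j); rewrite mem_enum; split.
  - by move: jT jS; rewrite !inE negbK => -> ->.
  - by rewrite (inj_eq (@rshift_inj _ _)).
  rewrite !dsumE ?partE // !setCD1 !setCU1 ![tadd (mu (lpart _)) _]taddC.
  by apply: tle_tadd4; rewrite taddC [X in tle _ X]taddC.
Qed.

(** Adding [i] and its bar to [S] adds [i] to [lpart S] and removes it from [~: rpart S]. The
    symplectic relation at [S] is thus the exchange relation of [mu] for these two sets. *)
Lemma dsum_symplectic : SpDr nu.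
Proof.
split=> [|S cS]; first exact: dsum_valuated.
apply/tmin_twiceP; first exact: enum_uniq.
move=> i; rewrite mem_enum inE => /andP[iS1 iS2] /dsum_fin[].
rewrite !partE => cS1 f1 f2.
have iS1' : i \notin lpart S by rewrite inE.
have iS2' : i \in ~: rpart S by rewrite !inE.
rewrite cardU1_notin // in cS1.
have cS2 : #|~: rpart S| = r.+1.
  have := cardsC (rpart S); have := card_parts S; rewrite card_ord; lia.
have [|j [jS2 jS1 ji le_ji]] := exchange cS1 cS2 iS2' iS1'.
  by rewrite tadd_fin -setCU1 f1 f2.
exists j; split=> //; first by move: jS1 jS2; rewrite mem_enum !inE => -> ->.
rewrite !dsumE ?partE ?cardU1_notin // !setCU1.
by rewrite taddC [X in tle _ X]taddC.
Qed.

(** The vector is tested on [T] together with the barred complement of a basis [B]; the surviving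
    terms are those of [T], all shifted by [mu B]. *)
Lemma lin_space_left (x : 'I_(n + n) -> trop R) : Lnu n nu x -> Lnu r mu (fun i =>
    x (lshift n i)).
Proof.
move=> Lx T cT; have [B cB fB] := basis_exists.
have cU : #|join_parts T (~: B)| = n.+1.
  rewrite -card_parts lpart_join rpart_join; have := cardsC B.
  rewrite card_ord; lia.
apply/tmin_twiceP => [|i]; first exact: enum_uniq.
rewrite mem_enum tadd_fin => iT /andP[fi xi].
have fin : tadd (nu (join_parts T (~: B) :\ lshift n i)) (x (lshift n i)) != None.
  rewrite dsumE !partE ?lpart_join ?rpart_join ?setCK ?tadd_fin ?fi ?fB ?xi //.
  exact: cardD1_pred cT.
have /tmin_twiceP := Lx _ cU; case/(_ (enum_uniq _) (lshift n i)) => //.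
  by rewrite mem_enum inE split_lshift.
move=> k []; rewrite mem_enum; case: (split_ordP k) => j ->.
  rewrite inE split_lshift (inj_eq (@lshift_inj _ _)) => jT ji le_ji.
  exists j; rewrite mem_enum; split=> //; move: le_ji.
  rewrite !dsumE !partE lpart_join ?rpart_join ?setCK.
  - by case: (mu B) fB (mu (T :\ j)) (mu (T :\ i)) (x _) (x _) =>
      [b|]// _ [?|] [?|] [?|] [?|] //=; lra.
  - exact: cardD1_pred cT.
  - exact: cardD1_pred cT.
(* Deleting a barred element leaves [r.+1] unbarred ones, so that term is infinite. *)
move=> _ _ /(tle_fin fin); rewrite tadd_fin => /andP[/dsum_fin[]].
by rewrite !partE lpart_join cT; lia.
Qed.

Lemma lin_space_right (x : 'I_(n + n) -> trop R) :
  Lnu n nu x -> Lnu (n - r) (mdual mu) (fun i => x (rshift n i)).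
Proof.
move=> Lx T cT; have [B cB fB] := basis_exists; have rn := rank_le.
have cU : #|join_parts B T| = n.+1.
  rewrite -card_parts lpart_join rpart_join; lia.
apply/tmin_twiceP => [|i]; first exact: enum_uniq.
rewrite mem_enum tadd_fin => iT /andP[fi xi].
have fin : tadd (nu (join_parts B T :\ rshift n i)) (x (rshift n i)) != None.
  by rewrite dsumE !partE ?lpart_join ?rpart_join ?tadd_fin ?fB ?[mu _ != None]fi ?xi.
have /tmin_twiceP := Lx _ cU; case/(_ (enum_uniq _) (rshift n i)) => //.
  by rewrite mem_enum inE split_rshift.
move=> k []; rewrite mem_enum; case: (split_ordP k) => j ->; last first.
  rewrite inE split_rshift (inj_eq (@rshift_inj _ _)) => jT ji le_ji.
  exists j; rewrite mem_enum; split=> //; move: le_ji.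
  rewrite !dsumE !partE ?lpart_join ?rpart_join // /mdual.
  by case: (mu B) fB (mu (~: (T :\ j))) (mu (~: (T :\ i))) (x _) (x _) =>
      [b|]// _ [?|] [?|] [?|] [?|] //=; lra.
(* Deleting an element of [B] leaves too few unbarred elements for a finite term. *)
rewrite inE split_lshift => jB _ /(tle_fin fin); rewrite tadd_fin.
case/andP=> /dsum_fin[]; rewrite !partE lpart_join.
by move=> c1; have := cardD1_in jB; rewrite cB c1; lia.
Qed.

(** * Orthogonality of dual tropical linear spaces *)

Let inf_part x B := [set i in B | x i == None].
(** The default [0] drops the infinite coordinates of [x], which [inf_part] records separately. *)
Let weight x B := odflt 0 (mu B) - \sum_(i in B) odflt 0 (x i).

(* Infinite coordinates of [x] count as infinitely large, so that minimizing
   [mu B - x(B)] means first maximizing the number of those in [B]. *)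
Definition optimal x B :=
  [/\ #|B| = r, mu B != None,
     forall B', #|B'| = r -> mu B' != None -> (#|inf_part x B'| <= #|inf_part x B|)%N &
     forall B', #|B'| = r -> mu B' != None -> #|inf_part x B'| = #|inf_part x B| ->
       weight x B <= weight x B'].

Lemma optimal_exists x : exists B, optimal x B.
Proof.
have [B0 cB0 fB0] := basis_exists.
pose Z B := #|inf_part x B|.
pose basis (B : {set 'I_n}) := (#|B| == r) && (mu B != None).
have bB0 : basis B0 by rewrite /basis cB0 eqxx.
case: (@arg_maxnP _ B0 basis Z bB0) => B1 bB1 maxB1.
(* The second optimization runs only over bases that already maximize the number of infinite
   coordinates. *)
pose opt B := basis B && (Z B == Z B1).
have oB1 : opt B1 by rewrite /opt bB1 eqxx.
case: (@arg_minP _ _ _ B1 opt (weight x) oB1) => B.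
case/andP=> /andP[/eqP cB fB] /eqP ZB minB.
exists B; split=> // B' cB' fB'.
  by rewrite -/(Z B') -/(Z B) ZB; apply: maxB1; rewrite /basis cB' eqxx.
rewrite -/(Z B') -/(Z B) ZB => ZB'.
by apply: minB; rewrite /opt /basis cB' fB' ZB' !eqxx.
Qed.

Section Swap.
Variables (x : 'I_n -> trop R) (B : {set 'I_n}) (i j : 'I_n).
Hypotheses (iB : i \notin B) (jB : j \in B).

Lemma sum_swap (f : 'I_n -> R) :
  \sum_(k in i |: (B :\ j)) f k = f i + \sum_(k in B) f k - f j.
Proof.
rewrite big_setU1 ?inE ?(negPf iB) ?andbF //= [X in _ = _ + X - _](big_setD1 j) //=.
by rewrite [f j + _]addrC addrA addrK.
Qed.

Lemma inf_part_swap : x i != None -> x j != None ->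
  inf_part x (i |: (B :\ j)) = inf_part x B.
Proof.
move=> xi xj; apply/setP => k; rewrite !inE.
have [->|_] := eqVneq k i; first by rewrite (negPf xi) !andbF.
by have [->|_] := eqVneq k j; first by rewrite (negPf xj) !andbF.
Qed.

Lemma inf_part_swap_lt : x i == None -> x j != None ->
  (#|inf_part x B| < #|inf_part x (i |: (B :\ j))|)%N.
Proof.
move=> xi xj; rewrite -[X in (_ < X)%N](_ : #|i |: inf_part x B| = _).
  by rewrite cardU1_notin // inE (negPf iB).
congr #|pred_of_set _|; apply/setP => k; rewrite !inE.
have [->|_] := eqVneq k i; first by rewrite xi.
by have [->|_] := eqVneq k j; first by rewrite (negPf xj) !andbF.
Qed.

End Swap.

(* If [i0] is not in the optimal basis [B], the circuit of [i0 |: B] tested on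
   [x] exchanges it in at no cost; the cocircuit of [B :\ i0] tested on [y]
   then yields the second minimum. *)
Lemma lin_space_dual_orthogonal x y i0 :
  Lnu r mu x -> Lnu (n - r) (mdual mu) y -> x i0 != None -> y i0 != None ->
  exists2 j, j != i0 & tle (tadd (x j) (y j)) (tadd (x i0) (y i0)).
Proof.
move=> Lx Ly xi0 yi0.
have [B [cB fB maxB minB] i0B] : exists2 B, optimal x B & i0 \in B.
  have [B [cB fB maxB minB]] := optimal_exists x.
  have [i0B|i0B] := boolP (i0 \in B); first by exists B.
  have cT : #|i0 |: B| = r.+1 by rewrite cardU1_notin ?cB.
  have /tmin_twiceP := Lx _ cT; case/(_ (enum_uniq _) i0).
  - by rewrite mem_enum setU11.
  - by rewrite setU1K // tadd_fin fB.
  move=> j [+ ji0]; rewrite mem_enum setU1K // !inE (negPf ji0) /= => jB le_j.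
  have TE : (i0 |: B) :\ j = i0 |: (B :\ j).
    by apply/setP => k; rewrite !inE; have [->|] := eqVneq k i0;
        rewrite ?andbT // eq_sym.
  rewrite TE in le_j.
  have : tadd (mu (i0 |: (B :\ j))) (x j) != None.
    by apply: tle_fin le_j; rewrite tadd_fin fB.
  rewrite tadd_fin => /andP[fB' xj].
  (* Both swapped coordinates are finite, so [inf_part] is unchanged, and [le_j] says that the
     weight does not increase: the new basis is again optimal. *)
  exists (i0 |: (B :\ j)); last exact: setU11.
  split=> //; rewrite ?card_swap ?inf_part_swap // => B' cB' fB'' ZB'.
  apply: le_trans (minB _ cB' fB'' ZB'); rewrite /weight sum_swap //.
  move: le_j; case: (mu B) fB (mu _) fB' (x j) (x i0) xj xi0 =>
      [b|]// _ [b'|]// _ [xj|]// [xi|]//= _ _.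
  lra.
have rn := rank_le.
have cT : #|~: (B :\ i0)| = (n - r).+1.
  have := cardsC (B :\ i0); rewrite card_ord; have := cardD1_in i0B.
  rewrite cB; move: #|B :\ i0| #|~: _| => p q; lia.
have muE j : mdual mu (~: (B :\ i0) :\ j) = mu (j |: (B :\ i0)).
  by rewrite /mdual setCD1 setCK.
have /tmin_twiceP := Ly _ cT; case/(_ (enum_uniq _) i0).
- by rewrite mem_enum !inE eqxx.
- by rewrite muE setD1K // tadd_fin fB.
move=> j [+ ji0]; rewrite mem_enum !muE setD1K // !inE ji0 /= => jB le_j.
have : tadd (mu (j |: (B :\ i0))) (y j) != None.
  by apply: tle_fin le_j; rewrite tadd_fin fB.
rewrite tadd_fin => /andP[fB' yj].
have cB' : #|j |: (B :\ i0)| = r by rewrite card_swap.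
(* Otherwise the swap would gain an infinite coordinate, against [maxB]. *)
have xj : x j != None.
  apply/negP => xj; have := inf_part_swap_lt jB xj xi0.
  by rewrite ltnNge maxB.
(* Optimality bounds [x j - x i0] by the change of [mu] under the swap, and the cocircuit bounds
   that change by [y i0 - y j]. *)
exists j => //; have := minB _ cB' fB'; rewrite inf_part_swap // => /(_ erefl).
rewrite /weight sum_swap //; move: le_j fB fB' xi0 yi0 xj yj.
case: (mu B) (mu _) (x j) (x i0) (y j) (y i0) =>
    [b|]// [b'|]// [?|]// [?|]// [?|]// [?|]//=.
lra.
Qed.

(** Each term pairs the [mu] half of one point with the dual half of the other, so a second minimum
    is found on the same side. Positivity of [n] provides at least two terms. *)
Lemma conormal_isotropic : (0 < n)%N -> isotropic (Lnu n nu).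
Proof.
move=> n_gt0 x y Lx Ly; apply: tmin_twice_attained.
  by rewrite size_map size_enum_ord; lia.
apply/tmin_twiceP => [|k _]; first exact: enum_uniq.
rewrite tadd_fin => /andP[]; case: (split_ordP k) => i ->; rewrite ?bar_l ?bar_r =>
    xi yi.
- have [j ji le_j] :=
    lin_space_dual_orthogonal (lin_space_left Lx) (lin_space_right Ly) xi yi.
  by exists (lshift n j); rewrite mem_enum bar_l (inj_eq (@lshift_inj _ _)).
- have [j ji le_j] :=
    lin_space_dual_orthogonal (lin_space_left Ly) (lin_space_right Lx) yi xi.
  exists (rshift n j); rewrite mem_enum bar_r (inj_eq (@rshift_inj _ _)).
  by rewrite taddC [X in tle _ X]taddC.
Qed.

End ConormalBundle.

(** This allows matchings and minors to be described by any convenient injection instead of a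
    permutation of the fixed enumeration of [J]. *)
Lemma enum_val_factor (E : finType) (k : nat) (J : {set E}) (e : #|J| = k)
    (f : 'I_k -> E) : injective f -> (forall i, f i \in J) ->
  exists s : {perm 'I_k}, forall i, f i = enum_val (cast_ord (esym e) (s i)).
Proof.
move=> f_inj fJ; pose g i := cast_ord e (enum_rank_in (fJ i) (f i)).
have gE i : enum_val (cast_ord (esym e) (g i)) = f i.
  by rewrite cast_ordK enum_rankK_in.
have g_inj : injective g by move=> i j gij; apply: f_inj; rewrite -!gE gij.
by exists (perm g_inj) => i; rewrite permE gE.
Qed.

(** * Supports of Stiefel coordinates as matchings of rows to columns *)

Section StiefelSupport.
Variable R : realType.
Implicit Types s : seq (trop R).

Lemma tsum_fin s : (tsum s != None) = all (fun a => a != None) s.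
Proof. by elim: s => //= a s IH; rewrite tadd_fin IH. Qed.

Lemma tmin_seq_fin s : (tmin_seq s != None) = has (fun a => a != None) s.
Proof.
elim: s => //= a s <-; rewrite /tmin.
by case: a (tmin_seq s) => [a|] [b|] //=; case: ifP.
Qed.

Variables (k m : nat) (M : 'I_k -> 'I_m -> trop R).

Lemma stiefel_finP (J : {set 'I_m}) : #|J| = k ->
  stiefel M J != None <->
  exists2 f : 'I_k -> 'I_m, injective f & forall i, f i \in J /\ M i (f i) != None.
Proof.
rewrite /stiefel; case: (_ =P k) => // e _; rewrite tmin_seq_fin has_map.
split=> [/hasP[s _] /=|[f f_inj fJM]].
  rewrite tsum_fin all_map => /allP Ms.
  exists (fun i => enum_val (cast_ord (esym e) (s i))) => [i j|i].
    by move/enum_val_inj/cast_ord_inj/perm_inj.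
  by split; [apply: enum_valP | apply: Ms; rewrite mem_enum].
have [|s fE] := enum_val_factor e f_inj; first by move=> i; have [] := fJM i.
apply/hasP; exists s; first by rewrite mem_enum inE.
rewrite /= tsum_fin all_map; apply/allP => i _ /=.
by rewrite -fE; have [] := fJM i.
Qed.

Lemma matching_onto (J : {set 'I_m}) (f : 'I_k -> 'I_m) c :
  #|J| = k -> injective f -> (forall i, f i \in J) -> c \in J -> exists i, f i = c.
Proof.
move=> cJ f_inj fJ cinJ; suff /imsetP[i _ ->] : c \in f @: setT by exists i.
suff /eqP-> : f @: setT == J by [].
rewrite eqEcard card_imset // cardsT card_ord cJ leqnn andbT.
by apply/subsetP => _ /imsetP[i _ ->].
Qed.

(** Row [i] is rematched to [c], which frees the column [f i]; all other rows keep their columns. *)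
Lemma stiefel_swap (J : {set 'I_m}) (f : 'I_k -> 'I_m) i c :
  #|J| = k -> injective f -> (forall j, f j \in J /\ M j (f j) != None) ->
  c \notin J -> M i c != None ->
  #|c |: (J :\ f i)| = k /\ stiefel M (c |: (J :\ f i)) != None.
Proof.
move=> cJ f_inj fJM cnJ Mic; have fiJ : f i \in J by case: (fJM i).
have cJ' : #|c |: (J :\ f i)| = k by rewrite card_swap.
split=> //; apply/stiefel_finP => //.
have fc j : f j != c by apply: contraNneq cnJ => <-; case: (fJM j).
exists (fun j => if j == i then c else f j) => [j1 j2|j].
  case: eqP => [->|_]; case: eqP => [->|_] // E.
  - by move: (fc j2); rewrite -E eqxx.
  - by move: (fc j1); rewrite E eqxx.
  - exact: f_inj.
have [->|ji] := eqVneq j i; first by rewrite setU11.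
have [fJ Mj] := fJM j; split=> //.
by rewrite !inE (inj_eq f_inj) ji fJ orbT.
Qed.

End StiefelSupport.

(** * Symmetric presentations of the direct sum *)

Section SymmetricPresentation.
Variables (R : realType) (n r : nat) (mu : {set 'I_n} -> trop R).
Hypothesis mu_vm : valuated_matroid r mu.
Let nu := dsum r mu (mdual mu).
Let basis (B : {set 'I_n}) := #|B| = r /\ mu B != None.

Lemma proj_eq_fin (E : finType) k (f g : {set E} -> trop R) (J : {set E}) :
  proj_eq k f g -> #|J| = k -> (f J != None) = (g J != None).
Proof. by case=> c fg /fg ->; rewrite tadd_fin andbT. Qed.

Lemma card_join (B1 B2 : {set 'I_n}) :
  basis B1 -> basis B2 -> #|join_parts B1 (~: B2)| = n.
Proof.
move=> [c1 _] [c2 _]; rewrite -card_parts lpart_join rpart_join.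
by rewrite c1 -c2 cardsC card_ord.
Qed.

Lemma dsum_join_fin (B1 B2 : {set 'I_n}) :
  basis B1 -> basis B2 -> nu (join_parts B1 (~: B2)) != None.
Proof.
move=> [c1 f1] [_ f2].
by rewrite /nu dsumE lpart_join // rpart_join setCK tadd_fin f1.
Qed.

(* Swapping a column of a matching for another one of the same row yields a new
   basis, hence never changes sides; so no row meets both sides outside the
   coloops. *)
Lemma row_one_sided (M : 'I_n -> 'I_(n + n) -> trop R) i a b B1 B2 :
  proj_eq n nu (stiefel M) -> basis B1 -> basis B2 ->
  M i (lshift n a) != None -> M i (rshift n b) != None ->
  a \in B1 \/ b \notin B2.
Proof.
move=> nuM bB1 bB2 Ma Mb.
have [|aB1] := boolP (a \in B1); [by left|].
have [|bB2'] := boolP (b \notin B2); [by right|exfalso].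
have cJ := card_join bB1 bB2; set J := join_parts _ _ in cJ.
have : stiefel M J != None by rewrite -(proj_eq_fin nuM cJ) dsum_join_fin.
case/(stiefel_finP _ cJ) => f f_inj fJM.
have aJ : lshift n a \notin J by rewrite inE split_lshift.
have bJ : rshift n b \notin J by rewrite inE split_rshift inE.
have := (fJM i).1; case: (split_ordP (f i)) => c fi;
    rewrite fi inE ?split_lshift ?split_rshift => cJi.
- have [cJ' fJ'] := stiefel_swap cJ f_inj fJM bJ Mb.
  move: fJ'; rewrite -(proj_eq_fin nuM cJ') => /dsum_fin[].
  rewrite fi !partE lpart_join; have := cardD1_in cJi; rewrite bB1.1.
  by move=> -> /n_Sn.
- have [cJ' fJ'] := stiefel_swap cJ f_inj fJM aJ Ma.
  move: fJ'; rewrite -(proj_eq_fin nuM cJ') => /dsum_fin[].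
  rewrite fi !partE lpart_join cardU1_notin // bB1.1.
  by move=> /esym/n_Sn.
Qed.

Lemma symmetric_presentation_single_basis :
  symmetric_presentation nu -> single_basis r mu.
Proof.
case=> A [C [nuM sym]]; have [B cB fB] := basis_exists mu_vm.
have bB : basis B by [].
apply/eqP/cards1P; exists B; apply/setP => B1; rewrite !inE.
apply/andP/eqP => [[/eqP cB1 fB1]|-> //]; last by rewrite cB eqxx fB.
have bB1 : basis B1 by [].
apply/eqP; rewrite eq_sym eqEcard cB cB1 leqnn andbT.
apply/subsetP => a aB; apply/negPn/negP => aB1.
(* Since [a] lies in [B] but not in [B1], this basis of the direct sum contains both [a] and its
   bar, matched to rows [i] and [j]. *)
have cJ := card_join bB bB1; set J := join_parts _ _ in cJ.
have : stiefel (concat_mx A C) J != None.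
  by rewrite -(proj_eq_fin nuM cJ) dsum_join_fin.
case/(stiefel_finP _ cJ) => f f_inj fJM.
have onto c := matching_onto cJ f_inj (fun i => (fJM i).1) (c := c).
have [|i fi] := onto (lshift n a); first by rewrite inE split_lshift.
have [|j fj] := onto (rshift n a); first by rewrite inE split_rshift inE.
have Aia : concat_mx A C i (lshift n a) != None by rewrite -fi; case: (fJM i).
have Cja : concat_mx A C j (rshift n a) != None by rewrite -fj; case: (fJM j).
have : tmulT A C j i != None.
  rewrite -sym tmin_seq_fin has_map; apply/hasP; exists a; first by rewrite mem_enum.
  move: Aia Cja; rewrite /concat_mx split_lshift split_rshift /= tadd_fin => -> //.
rewrite tmin_seq_fin has_map => /hasP[l _] /=; rewrite tadd_fin => /andP[Ajl Cil].
have Mjl : concat_mx A C j (lshift n l) != None by rewrite /concat_mx split_lshift.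
have Mil : concat_mx A C i (rshift n l) != None by rewrite /concat_mx split_rshift.
(* Row [j] meets [l] and the bar of [a], which forces [l] into [B]; row [i] meets [a] and the bar of
   [l], which forces [l] out of [B]. *)
have [lB|] := row_one_sided nuM bB bB Mjl Cja; last by rewrite aB.
have [|] := row_one_sided nuM bB1 bB Aia Mil; first by rewrite (negPf aB1).
by rewrite lB.
Qed.

Lemma single_basis_symmetric_presentation :
  single_basis r mu -> symmetric_presentation nu.
Proof.
move/eqP/cards1P=> [B /setP basisE].
have bE B' : basis B' <-> B' = B.
  have := basisE B'; rewrite !inE => E; split=> [[c f]|/eqP].
    by apply/eqP; rewrite -E c eqxx f.
  by rewrite -E => /andP[/eqP].
have bB : basis B by apply/bE.
(* Diagonal matrices with complementary supports: every entry of the product is infinite, hence the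
   product is symmetric. *)
pose A (i j : 'I_n) : trop R := if (i == j) && (i \in B) then Some 0 else None.
pose C (i j : 'I_n) : trop R := if (i == j) && (i \notin B) then Some 0 else None.
exists A, C; split; last first.
  suff E i j : tmulT A C i j = None by move=> i j; rewrite !E.
  apply/eqP; rewrite -[_ == _]negbK tmin_seq_fin has_map; apply/hasPn => l _ /=.
  rewrite tadd_fin /A /C; have [->|_] := eqVneq i l; have [->|_] := eqVneq j l;
    by case: (l \in B).
pose J0 := join_parts B (~: B); have cJ0 : #|J0| = n by apply: card_join.
pose g i := if i \in B then lshift n i else rshift n i.
have gJ0 i : g i \in J0.
  by rewrite inE /g; case: ifP => iB; rewrite ?split_lshift ?split_rshift ?inE iB.
have g_inj : injective g.
  move=> i j; rewrite /g; case: ifP => _; case: ifP => _ /eqP;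
      rewrite ?eq_shift //; by move/eqP.
(* Each row has a single finite entry, so [g] is the only matching and [J0] the only finite
   coordinate. *)
have MP i c : (concat_mx A C i c != None) = (c == g i).
  rewrite /concat_mx /g; case: split_ordP => j ->; rewrite /A /C [i == j]eq_sym;
    by case: (i \in B); rewrite ?andbT ?andbF ?eq_shift //; case: (j == i).
have MJ0 : stiefel (concat_mx A C) J0 != None.
  apply/stiefel_finP => //; exists g => // i; split=> //; by rewrite MP.
have MJ (J : {set 'I_(n + n)}) : #|J| = n -> J != J0 -> stiefel (concat_mx A C) J =
    None.
  move=> cJ JJ0; apply/eqP; apply: contraNT JJ0 => /(stiefel_finP _ cJ)[f f_inj fJ].
  rewrite eq_sym eqEcard cJ cJ0 leqnn andbT; apply/subsetP => c cJ0'.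
  have [i <-] := matching_onto cJ0 g_inj gJ0 cJ0'.
  by have [? ] := fJ i; rewrite MP => /eqP <-.
have nuJ (J : {set 'I_(n + n)}) : #|J| = n -> J != J0 -> nu J = None.
  move=> cJ JJ0; apply/eqP; apply: contraNT JJ0 => /dsum_fin[c1 f1 f2].
  have lB : lpart J = B by apply/bE.
  have rB : ~: rpart J = B.
    apply/bE; split=> //; have := cardsC (rpart J); have := card_parts J.
    by rewrite card_ord cJ c1; lia.
  by rewrite -(join_parts_id J) lB -[rpart J]setCK rB.
have nuJ0 : nu J0 != None by apply: dsum_join_fin.
case E1: (nu J0) nuJ0 => [a|//] _; case E2: (stiefel _ J0) MJ0 => [b|//] _.
exists (a - b) => J cJ; have [->|JJ0] := eqVneq J J0.
  by rewrite E1 E2 /= addrC subrK.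
by rewrite nuJ // MJ.
Qed.

End SymmetricPresentation.

(** * Maximal minors and completion to an invertible matrix *)

Section Minors.
Variable K : fieldType.

(** Reordering columns changes a minor by a sign, left unspecified because valuations do not see
    it. *)
Lemma pminor_sign (k m : nat) (M : 'M[K]_(k, m)) (J : {set 'I_m}) (f : 'I_k -> 'I_m) :
  #|J| = k -> injective f -> (forall i, f i \in J) ->
  exists b : bool, \det (colsub f M) = (-1) ^+ b * pminor M J.
Proof.
move=> cJ f_inj fJ; rewrite /pminor; case: (_ =P k) => // e.
have [s fE] := enum_val_factor e f_inj fJ.
exists s; rewrite mulrC -odd_permV -det_perm -det_mulmx -col_permE.
by congr (\det _); apply/matrixP => i j; rewrite !mxE fE.
Qed.

Lemma pminor_mulmx (k m : nat) (D : 'M[K]_k) (M : 'M[K]_(k, m)) (J : {set 'I_m}) :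
  pminor (D *m M) J = \det D * pminor M J.
Proof.
rewrite /pminor; case: (_ =P k) => [e|_]; last by rewrite mulr0.
rewrite -det_mulmx; congr (\det _); apply/matrixP => i j; rewrite !mxE.
by apply: eq_bigr => l _; rewrite mxE.
Qed.

(** In the rank factorization of [M] the middle factor is an identity followed by zeros; bordering
    [col_ebase M] with an identity block makes the product invertible. *)
Lemma row_free_completion (r m : nat) (M : 'M[K]_(r, r + m)) :
  row_free M -> exists2 W : 'M[K]_(r + m), W \in unitmx & usubmx W = M.
Proof.
move/eqP=> rkM.
exists (block_mx (col_ebase M) 0 0 1%:M *m row_ebase M).
  rewrite unitmx_mul row_ebase_unit andbT unitmxE det_ublock det1 mulr1.
  by rewrite -unitmxE col_ebase_unit.
rewrite -mul_usub_mx block_mxEv col_mxKu -[RHS]mulmx_ebase rkM.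
by rewrite pid_mx_row mul_mx_row mulmx1 mulmx0.
Qed.

(** * The Lagrangian matrix of the conormal bundle and its minors *)

Section ConormalMatrix.
Variables (r m : nat) (W : 'M[K]_(r + m)).
Hypothesis Wunit : W \in unitmx.

Definition annihilator_mx : 'M[K]_(m, r + m) := (rsubmx (invmx W))^T.

Definition conormal_mx : 'M[K]_(r + m, (r + m) + (r + m)) :=
  block_mx (usubmx W) 0 0 annihilator_mx.

Lemma mul_invmx_block : block_mx
    (usubmx W *m lsubmx (invmx W)) (usubmx W *m annihilator_mx^T)
    (dsubmx W *m lsubmx (invmx W)) (dsubmx W *m annihilator_mx^T) = 1%:M.
Proof. by rewrite trmxK -mul_col_row vsubmxK hsubmxK mulmxV. Qed.

(** The outer equations give one-sided inverses, hence full rank of the two diagonal blocks; the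
    middle one is their orthogonality. *)
Lemma mul_invmx_blocks :
  [/\ usubmx W *m lsubmx (invmx W) = 1%:M, usubmx W *m annihilator_mx^T = 0 &
     dsubmx W *m annihilator_mx^T = 1%:M].
Proof.
by have := mul_invmx_block; rewrite (@scalar_mx_block _ r m) => /eq_block_mx[].
Qed.

Lemma conormal_mx_free : row_free conormal_mx.
Proof.
have [WV _ WN] := mul_invmx_blocks; rewrite /row_free rank_diag_block_mx.
have /eqP -> : row_free (usubmx W) by apply/row_freeP; exists (lsubmx (invmx W)).
have /eqP -> // : row_free annihilator_mx.
apply/row_freeP; exists (dsubmx W)^T; apply: trmx_inj.
by rewrite trmx_mul trmxK WN trmx1.
Qed.

Lemma sympl_mxE n : sympl_mx K n = block_mx 0 1%:M (- 1%:M) 0.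
Proof.
apply/matrixP => a b; rewrite !mxE; case: splitP => i _; rewrite !mxE;
    case: splitP => j _; rewrite !mxE //.
Qed.

Lemma conormal_mx_isotropic :
  conormal_mx *m sympl_mx K (r + m) *m conormal_mx^T = 0.
Proof.
have [_ MN _] := mul_invmx_blocks;
    rewrite sympl_mxE /conormal_mx tr_block_mx !trmx0 !mulmx_block.
rewrite !(mulmx0, mul0mx, mulmxN, mulmx1, mulNmx, add0r, addr0).
rewrite MN.
have -> : annihilator_mx *m (usubmx W)^T = 0.
  by apply: trmx_inj; rewrite trmx_mul trmxK MN trmx0.
by rewrite oppr0; apply: block_mx_const.
Qed.

(** A nonzero Leibniz term matches the first [r] rows with unbarred columns and the last [m] with
    barred ones. As [J] has [r + m] elements, both lower bounds are equalities. *)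
Lemma conormal_minor_card (J : {set 'I_((r + m) + (r + m))}) :
  pminor conormal_mx J != 0 -> #|lpart J| = r.
Proof.
rewrite /pminor; case: (_ =P _) => [e|_]; last by rewrite eqxx.
apply: contraNeq => cl; rewrite /determinant big1 // => s _.
apply/eqP; rewrite mulf_eq0 signr_eq0 /=; apply: contraNT cl => nz.
pose f i := enum_val (cast_ord (esym e) (s i)).
have f_inj : injective f by move=> i j /enum_val_inj/cast_ord_inj/perm_inj.
have nzf i : conormal_mx i (f i) != 0.
  by move/prodf_neq0: nz => /(_ i isT); rewrite mxE.
have fJ i : f i \in J by apply: enum_valP.
have fl a : exists c, f (lshift m a) = lshift (r + m) c.
  have := nzf (lshift m a); case: (split_ordP (f (lshift m a))) => c ->.
    by exists c.
  by rewrite block_mxEur mxE eqxx.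
have fr b : exists c, f (rshift r b) = rshift (r + m) c.
  have := nzf (rshift r b); case: (split_ordP (f (rshift r b))) => c ->.
    by rewrite block_mxEdl mxE eqxx.
  by exists c.
have cl : (r <= #|lpart J|)%N.
  rewrite -[X in (X <= _)%N]card_ord -cardsT -(card_imset _ (inj_comp f_inj
      (@lshift_inj r m))).
  rewrite -(card_imset (mem (lpart J)) (@lshift_inj (r + m) (r + m))).
  apply/subset_leq_card/subsetP => _ /imsetP[a _ ->] /=.
  by have [c fc] := fl a; rewrite fc imset_f // inE -fc.
have cr : (m <= #|rpart J|)%N.
  rewrite -[X in (X <= _)%N]card_ord -cardsT -(card_imset _ (inj_comp f_inj
      (@rshift_inj r m))).
  rewrite -(card_imset (mem (rpart J)) (@rshift_inj (r + m) (r + m))).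
  apply/subset_leq_card/subsetP => _ /imsetP[a _ ->] /=.
  by have [c fc] := fr a; rewrite fc imset_f // inE -fc.
by apply/eqP; have := card_parts J; rewrite e; lia.
Qed.

Lemma conormal_minor (J : {set 'I_((r + m) + (r + m))}) :
  #|lpart J| = r -> #|rpart J| = m ->
  exists b : bool, pminor conormal_mx J =
    (-1) ^+ b * (pminor (usubmx W) (lpart J) * pminor annihilator_mx (rpart J)).
Proof.
move=> cl cr.
have cJ : #|J| = (r + m)%N by rewrite -card_parts cl cr.
pose fl (a : 'I_r) := enum_val (cast_ord (esym cl) a).
pose fr (b : 'I_m) := enum_val (cast_ord (esym cr) b).
have fl_inj : injective fl by move=> i j /enum_val_inj/cast_ord_inj.
have fr_inj : injective fr by move=> i j /enum_val_inj/cast_ord_inj.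
have flJ a : fl a \in lpart J by apply: enum_valP.
have frJ b : fr b \in rpart J by apply: enum_valP.
(* Listing unbarred columns before barred ones makes the submatrix block diagonal. *)
pose f i := match split i with
  inl a => lshift (r + m) (fl a) | inr b => rshift (r + m) (fr b) end.
have f_inj : injective f.
  move=> i j; rewrite /f; case: split_ordP => a ->; case: split_ordP => b -> /eqP;
    by rewrite eq_shift // => /eqP; first [move/fl_inj->|move/fr_inj->].
have fJ i : f i \in J.
  by rewrite /f; case: split_ordP => a _; [have := flJ a|have := frJ a]; rewrite inE.
have [b1 E1] := pminor_sign conormal_mx cJ f_inj fJ.
have [b2 E2] := pminor_sign (usubmx W) cl fl_inj flJ.
have [b3 E3] := pminor_sign annihilator_mx cr fr_inj frJ.
have : \det (colsub f conormal_mx) =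
    \det (colsub fl (usubmx W)) * \det (colsub fr annihilator_mx).
  rewrite -(det_lblock _ 0); congr (\det _); apply/matrixP => i j.
  rewrite mxE; case: (split_ordP i) => a ->; case: (split_ordP j) => c ->;
    rewrite /f ?split_lshift ?split_rshift;
    by rewrite ?(block_mxEul, block_mxEur, block_mxEdl, block_mxEdr) !mxE.
rewrite E1 E2 E3 => E; exists (b1 (+) b2 (+) b3); rewrite -[LHS](signrMK b1) E.
by rewrite !signr_addb [X in _ * X]mulrACA !mulrA.
Qed.

(* Jacobi's identity between complementary minors of [W] and of its inverse. *)
Lemma annihilator_minor (J : {set 'I_(r + m)}) : #|J| = r ->
  exists b : bool, pminor (usubmx W) J =
    (-1) ^+ b * (\det W * pminor annihilator_mx (~: J)).
Proof.
move=> cJ; have cJc : #|~: J| = m by have := cardsC J; rewrite card_ord; lia.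
pose fl (a : 'I_r) := enum_val (cast_ord (esym cJ) a).
pose fr (b : 'I_m) := enum_val (cast_ord (esym cJc) b).
have fl_inj : injective fl by move=> i j /enum_val_inj/cast_ord_inj.
have fr_inj : injective fr by move=> i j /enum_val_inj/cast_ord_inj.
have flJ a : fl a \in J by apply: enum_valP.
have frJ b : fr b \in ~: J by apply: enum_valP.
pose f i := match split i with inl a => fl a | inr b => fr b end.
have f_inj : injective f.
  have flr a b : fl a <> fr b.
    by move=> E; have := frJ b; rewrite -E inE flJ.
  move=> i j; rewrite /f; case: split_ordP => a ->; case: split_ordP => b ->.
  - by move/fl_inj->.
  - by move/flr.
  - by move/esym/flr.
  - by move/fr_inj->.
pose h := perm f_inj.
have [b2 E2] := pminor_sign (usubmx W) cJ fl_inj flJ.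
have [b3 E3] := pminor_sign annihilator_mx cJc fr_inj frJ.
pose Wh := col_perm h W; pose Vh := row_perm h (invmx W).
have WVh : Wh *m Vh = 1%:M.
  rewrite /Wh /Vh col_permE row_permE mulmxA -[W *m _ *m _]mulmxA -perm_mxM.
  by rewrite mulVg perm_mx1 mulmx1 mulmxV.
(* Replacing the left columns of the inverse by those of the identity gives triangular blocks on
   both sides, so determinants relate the two complementary minors. *)
have WVhr : Wh *m block_mx 1%:M (ursubmx Vh) 0 (drsubmx Vh) =
    block_mx (ulsubmx Wh) 0 (dlsubmx Wh) 1%:M.
  move: WVh; rewrite -{1 2}(submxK Wh) -{1}(submxK Vh) !mulmx_block.
  rewrite (@scalar_mx_block _ r m) => /eq_block_mx[_ -> _ ->].
  by rewrite !mulmx1 !mulmx0 !addr0.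
have := congr1 (fun X => \det X) WVhr.
rewrite det_mulmx det_ublock det_lblock !det1 mul1r mulr1.
have -> : ulsubmx Wh = colsub fl (usubmx W).
  by apply/matrixP => a b; rewrite !mxE permE /f split_lshift.
have -> : \det (drsubmx Vh) = \det (colsub fr annihilator_mx).
  rewrite -det_tr; congr (\det _).
  by apply/matrixP => a b; rewrite !mxE permE /f split_rshift.
rewrite E2 E3 /Wh col_permE det_mulmx det_perm; move: (odd_perm _) => b1 E.
exists (b1 (+) b2 (+) b3); rewrite -[LHS](signrMK b2) -E !signr_addb.
by rewrite [\det W * (-1) ^+ _]mulrC [X in _ * X = _]mulrACA !mulrA [_ * (-1) ^+
    b1]mulrC.
Qed.
End ConormalMatrix.
End Minors.

(** * Valuations of sums and monomials *)

Section Valuation.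
Variables (R : realType) (K : fieldType) (v : K -> trop R).
Hypothesis v_val : is_valuation v.

Lemma val_fin x : (v x != None) = (x != 0).
Proof. by case: v_val => ->. Qed.

Lemma valM x y : v (x * y) = tadd (v x) (v y).
Proof. by case: v_val => _ []. Qed.

Lemma val0 : v 0 = None.
Proof. by apply/eqP; case: v_val => ->. Qed.

Lemma val_unity x : x * x = 1 -> v x = Some 0.
Proof.
have v1 : v 1 = Some 0.
  have := val_fin 1; have := valM 1 1; rewrite mulr1 oner_eq0.
  by case: (v 1) => // a [] E _; congr Some; lra.
move=> /(congr1 v); rewrite valM v1; case: (v x) => //= a [] E; congr Some; lra.
Qed.

Lemma val1 : v 1 = Some 0.
Proof. by apply: val_unity; rewrite mulr1. Qed.

Lemma val_sign (b : bool) x : v ((-1) ^+ b * x) = v x.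
Proof.
rewrite valM (@val_unity ((-1) ^+ b)); last by rewrite -signr_addb addbb.
by case: (v x) => //= a; rewrite add0r.
Qed.

Lemma valN x : v (- x) = v x.
Proof. by rewrite -mulN1r -[-1]/((-1) ^+ true) val_sign. Qed.

Lemma val_sum_ge (I : Type) (s : seq I) (F : I -> K) :
  tle (tmin_seq [seq v (F i) | i <- s]) (v (\sum_(i <- s) F i)).
Proof.
elim: s => [|i s IH]; first by rewrite big_nil val0.
rewrite big_cons /=; case: v_val => _ [_ /(_ (F i) (\sum_(j <- s) F j))].
apply: tle_trans; rewrite tle_tmin.
have := tle_refl (tmin (v (F i)) (tmin_seq [seq v (F i) | i <- s])).
rewrite tle_tmin => /andP[-> le2]; exact: tle_trans IH.
Qed.

(** The term at [i] is minus the sum of the others, so by the ultrametric inequality one of these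
    has no larger valuation. *)
Lemma val_sum0_twice (I : eqType) (s : seq I) (F : I -> K) i : uniq s ->
  \sum_(j <- s) F j = 0 -> i \in s -> v (F i) != None ->
  exists j, [/\ j \in s, j != i & tle (v (F j)) (v (F i))].
Proof.
move=> us s0 si fi; move: s0; rewrite (big_rem i) //= => /eqP; rewrite addr_eq0 =>
    /eqP Fi.
have := val_sum_ge (rem i s) F; rewrite -valN -Fi => le_i.
have /mapP[j] := tmin_seq_mem (tle_fin fi le_i).
rewrite mem_rem_uniq // inE => /andP[ji js] E.
by exists j; split; rewrite // -E.
Qed.

(** The convention for the zeroth tropical power of infinity agrees with [x ^+ 0 = 1] at [x = 0]. *)
Lemma tnmul_val (k : nat) x c :
  tnmul k (tadd (v x) (Some c)) = tadd (v (x ^+ k)) (Some (c *+ k)).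
Proof.
have vX j : v (x ^+ j.+1) = omap (fun a => a *+ j.+1) (v x).
  elim: j => [|j IH]; first by rewrite expr1; case: (v x).
  by rewrite exprS valM IH; case: (v x) => //= a; rewrite [in RHS]mulrS.
case: k => [|k]; first by rewrite expr0 val1 mulr0n /= addr0.
by rewrite vX /tnmul /=; case: (v x) => //= a; rewrite mulrnDl.
Qed.

(** The shift contributes a multiple of the degree, hence is invisible among monomials of equal
    degree. *)
Lemma monomial_val N (u : 'X_{1..N}) (X : 'I_N -> K) c :
  tsum [seq tnmul (u i) (tadd (v (X i)) (Some c)) | i <- enum 'I_N] =
  tadd (v (\prod_i X i ^+ u i)) (Some (c *+ mdeg u)).
Proof.
rewrite mdegE -[\prod_i _]big_enum -[(\sum_i _)%N]big_enum /=.
elim: (enum 'I_N) => [|i s IH]; first by rewrite !big_nil val1 /= addr0.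
rewrite /= IH !big_cons tnmul_val valM mulrnDr.
by case: (v (X i ^+ _)) (v (\prod_(_ <- _) _)) => [a|] [b|] //=; congr Some; lra.
Qed.

End Valuation.

(* An infinite field separates the homogeneous components of [f] along the line
   through [X]. *)
Lemma homogeneous_components_vanish (K : closedFieldType) N (f : {mpoly K[N]})
    (X : 'I_N -> K) :
  (forall t, t != 0 -> f.@[fun i => t * X i] = 0) ->
  forall d, \sum_(u <- msupp f | mdeg u == d) f@_u * \prod_i X i ^+ u i = 0.
Proof.
move=> fX0 d; pose a u := f@_u * \prod_i X i ^+ u i.
(* Evaluating [P] at a nonzero [t] gives [f] at [t] times [X], and its coefficients are the sums to
   be annihilated. *)
pose P : {poly K} := \sum_(u <- msupp f) a u *: 'X^(mdeg u).
have Pt t : t != 0 -> P.[t] = 0.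
  move=> t0; rewrite -[RHS](fX0 t t0) mevalE horner_sum; apply: eq_bigr => u _.
  rewrite hornerZ hornerXn /a -mulrA; congr (_ * _).
  under [in RHS]eq_bigr do rewrite exprMn.
  by rewrite big_split /= mulrC mdegE; congr (_ * _); rewrite expr_sum.
have P0 : P = 0.
  apply/eqP/negPn/negP => P0.
  (* If [P] is nonzero, ['X * P + 1] is nonconstant and has a root; but its value is [1] at [0], and
     also wherever [P] vanishes. *)
  have /closed_rootP[t] : size ('X * P + 1) != 1%N.
    rewrite mulrC size_polyDl size_mulX ?size_poly1 //;
        first by rewrite eqSS size_poly_eq0.
    by rewrite ltnS lt0n size_poly_eq0.
  rewrite /root !hornerE; have [->|/Pt->] := eqVneq t 0.
    by rewrite mul0r add0r oner_eq0.
  by rewrite mulr0 add0r oner_eq0.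
have := coef0 K d; rewrite -P0 coef_sum => Pd; rewrite -[RHS]Pd big_mkcond /=.
apply: eq_bigr => u _; rewrite coefZ coefXn eq_sym.
by case: eqP => _; rewrite ?mulr1 ?mulr0.
Qed.

(** * Membership in the tropical symplectic Grassmannian *)

Lemma lagrangian_TSpGr (R : realType) (K : closedFieldType) (v : K -> trop R) n
    (M : 'M[K]_(n, n + n)) (w : {set 'I_(n + n)} -> trop R) c :
  is_valuation v -> (0 < n)%N -> row_free M -> M *m sympl_mx K n *m M^T = 0 ->
  (exists J : {set 'I_(n + n)}, #|J| = n /\ w J != None) ->
  (forall J : {set 'I_(n + n)}, #|J| = n -> w J = tadd (v (pminor M J)) (Some c)) ->
  TSpGr v w.
Proof.
move=> v_val n_gt0 Mfree Miso w_fin wE; split=> // f f0.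
pose X i := pminor M (@var_set n i).
have fX0 t : t != 0 -> f.@[fun i => t * X i] = 0.
  (* Scaling one row by [t] scales every maximal minor by [t] and keeps the row space Lagrangian. *)
  move=> t0; pose d : 'rV[K]_n := \row_i (if i == Ordinal n_gt0 then t else 1).
  have dD : \det (diag_mx d) = t.
    rewrite det_diag (bigD1 (Ordinal n_gt0)) //= mxE eqxx big1 ?mulr1 // => i.
    by rewrite mxE => /negPf ->.
  rewrite -[RHS](f0 (diag_mx d *m M)).
  - by apply: meval_eq => i; rewrite pminor_mulmx dD.
  - have dU : diag_mx d \in unitmx by rewrite unitmxE dD unitfE.
    by rewrite /row_free mxrankMfree // -/(row_free _) row_free_unit.
  - by rewrite trmx_mul -!mulmxA [M *m _]mulmxA [M *m _ *m _]mulmxA Miso mul0mx mulmx0.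
apply/tmin_twiceP => [|u u_f]; first exact: msupp_uniq.
pose a u := f@_u * \prod_i X i ^+ u i.
have termE u' : tadd (v f@_u') (tsum [seq tnmul (u' i) (w (@var_set n i)) |
    i <- enum 'I_#|nsubsets n|]) = tadd (v (a u')) (Some (c *+ mdeg u')).
  have -> : [seq tnmul (u' i) (w (@var_set n i)) | i <- enum 'I_#|nsubsets n|] =
            [seq tnmul (u' i) (tadd (v (X i)) (Some c)) | i <- enum 'I_#|nsubsets n|].
    apply: eq_map => i; rewrite wE //; apply/eqP.
    by have := enum_valP i; rewrite inE.
  rewrite monomial_val // valM //.
  by case: (v f@_u') (v (\prod_i _)) => [x|] [y|] //=; rewrite addrA.
rewrite termE tadd_fin andbT => fin_u.
(* Only terms of the degree of [u] are compared, so the shift by [c] is common to them. *)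
have := homogeneous_components_vanish fX0 (mdeg u); rewrite -big_filter => sum0.
have [||u' []] := val_sum0_twice v_val _ sum0 _ fin_u.
- exact/filter_uniq/msupp_uniq.
- by rewrite mem_filter eqxx.
rewrite mem_filter => /andP[/eqP du' u'_f] u'u le_u'.
exists u'; split=> //; rewrite !termE du'.
by move: le_u'; rewrite -!/(a _); case: (v (a u')) (v (a u)) => [x|] [y|] //=; lra.
Qed.

(** Minors commute with [phi], which preserves valuations; realizability thus passes to the closed
    field. *)
Lemma realizable_map (R : realType) (F K : fieldType) (vF : F -> trop R)
    (vK : K -> trop R) (phi : {rmorphism F -> K}) n r (mu : {set 'I_n} -> trop R) :
  (forall x, vK (phi x) = vF x) -> realizable vF r mu -> realizable vK r mu.
Proof.
move=> vE [M [Mfree [c muE]]]; exists (map_mx phi M); split.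
  by rewrite /row_free mxrank_map.
exists c => J cJ; rewrite muE // -vE; congr (tadd (vK _) _).
rewrite /pminor; case: (_ =P r) => // e; rewrite -det_map_mx; congr (\det _).
by apply/matrixP => i j; rewrite !mxE.
Qed.

Lemma conormal_TSpGr (R : realType) (K : closedFieldType) (v : K -> trop R) n r
    (mu : {set 'I_n} -> trop R) :
  is_valuation v -> (0 < n)%N -> valuated_matroid r mu -> realizable v r mu ->
  TSpGr v (dsum r mu (mdual mu)).
Proof.
move=> v_val n_gt0 mu_vm; have [m nE] : exists m, n = (r + m)%N.
  by exists (n - r)%N; rewrite subnKC // (rank_le mu_vm).
subst n => -[M [/row_free_completion[W Wunit <-] [c muE]]].
have := val_fin v_val (\det W); rewrite -unitfE -unitmxE Wunit.
case dW : (v (\det W)) => [d|//] _.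
(* Each value of [mu] contributes one [c], and the factor [\det W] in Jacobi's identity contributes
   [d]. *)
apply: (lagrangian_TSpGr (c := c + c + d) v_val n_gt0
  (conormal_mx_free Wunit) (conormal_mx_isotropic Wunit)).
  by have [J] := dsum_fin_exists mu_vm; exists J.
move=> J cJ; have [cl|cl] := eqVneq #|lpart J| r; last first.
  (* When the unbarred part has the wrong size, both sides are infinite. *)
  have -> : pminor (conormal_mx W) J = 0.
    by apply/eqP; apply: contraNT cl => /conormal_minor_card ->.
  by rewrite val0 // /dsum (negPf cl).
have cr : #|rpart J| = m by have := card_parts J; rewrite cJ cl; lia.
have crC : #|~: rpart J| = r by have := cardsC (rpart J); rewrite card_ord cr; lia.
have [b1 ->] := conormal_minor W cl cr.
have [b2 E2] := annihilator_minor Wunit crC.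
rewrite dsumE // !muE // E2 setCK !val_sign // !valM // dW.
by case: (v _) (v _) => [x|] [y|] //=; congr Some; lra.
Qed.

Theorem theorem8p2 (R : realType) (n r : nat) (mu : {set 'I_n} -> trop R)
    (n_gt0 : (0 < n)%N) (mu_vm : valuated_matroid r mu) :
  let nu : {set 'I_(n + n)} -> trop R := dsum r mu (mdual mu) in
  (* (1) *)
  (forall (p : nat) (F : fieldType) (vF : F -> trop R)
          (K : closedFieldType) (vK : K -> trop R) (phi : {rmorphism F -> K}),
      has_char p F -> has_char p K ->
      is_valuation vF -> is_valuation vK ->
      (forall x : F, vK (phi x) = vF x) ->
      realizable vF r mu ->
      TSpGr vK nu) /\
  (* (2) *)
  SpDr nu /\
  (* (3) *)
  isotropic (Lnu n nu) /\
  (* (4) *)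
  (trop_transversal r mu -> trop_transversal (n - r) (mdual mu) ->
     (symmetric_presentation nu <-> single_basis r mu)).
Proof.
split; last split; last split.
- move=> p F vF K vK phi _ _ _ vK_val vE /(realizable_map vE).
  exact: conormal_TSpGr.
- exact: dsum_symplectic.
- exact: conormal_isotropic.
- by move=> _ _; split; [apply: symmetric_presentation_single_basis |
                         apply: single_basis_symmetric_presentation].
Qed.
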